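(* Let $n\ge 3$ and let $K_{1,n}$ be the star with $n$ leaves. The nullity pairs outside $\{(0,0),(1,0),(0,1)\}$ allowed by $K_{1,n}$ rooted at its center are precisely the pairs $(\ell-1,\ell)$ with $2\le\ell\le n$. The nullity pairs outside $\{(0,0),(1,0),(0,1)\}$ allowed by $K_{1,n}$ rooted at a leaf are precisely the pairs $(\ell,\ell)$ and $(\ell+1,\ell)$ with $1\le\ell\le n-2$.
   Context: All matrices are real. For a simple graph $G$ on $[n]$, $\mathcal{S}(G)$ is the set of real symmetric $n\times n$ matrices whose off-diagonal $(j,k)$ entry is nonzero iff $\{j,k\}\in E(G)$ (diagonal free). $A(i)$ is $A$ with row and column $i$ deleted. $(G,i)$ allows the nullity pair $(k,\ell)$ if some $A\in\mathcal{S}(G)$ has $(\operatorname{null}(A),\operatorname{null}(A(i)))=(k,\ell)$. *)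

(* Defs.v *)
From HB Require Import structures.
From mathcomp Require Import all_boot all_order all_algebra.
From mathcomp Require Import reals.

Set Implicit Arguments.
Unset Strict Implicit.
Unset Printing Implicit Defensive.

Import GRing.Theory.
Local Open Scope ring_scope.

Record sgraph (n : nat) := SGraph {
  edge : rel 'I_n;
  edge_sym : symmetric edge;
  edge_irr : irreflexive edge }.

Definition sym_mx_of (R : realType) (n : nat) (G : sgraph n) (A : 'M[R]_n)
  : Prop :=
  A^T = A /\ forall j k : 'I_n, j != k -> (A j k != 0) = edge G j k.

Definition del_rowcol (R : realType) (n : nat) (i : 'I_n) (A : 'M[R]_n)
  : 'M[R]_n.-1 :=
  row' i (col' i A).

(* The row kernel; for the symmetric matrices used here it agrees with the
   column kernel up to transposition. *)
Definition nullity (R : realType) (n : nat) (A : 'M[R]_n) : nat :=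
  \rank (kermx A).

Definition allows_nullity_pair (R : realType) (n : nat) (G : sgraph n)
  (i : 'I_n) (p : nat * nat) : Prop :=
  exists2 A : 'M[R]_n, sym_mx_of G A &
    (nullity A, nullity (del_rowcol i A)) = p.

(* K_{1,n} on n + 1 vertices: the center is ord0, the leaves are the n
   vertices different from ord0. *)
Definition star_edge (n : nat) : rel 'I_n.+1 :=
  fun i j => (i == ord0) (+) (j == ord0).

Lemma star_edge_sym (n : nat) : symmetric (@star_edge n).
Proof. by move=> i j; rewrite /star_edge addbC. Qed.

Lemma star_edge_irr (n : nat) : irreflexive (@star_edge n).
Proof. by move=> i; rewrite /star_edge addbb. Qed.

Definition star (n : nat) : sgraph n.+1 :=
  SGraph (@star_edge_sym n) (@star_edge_irr n).

(* Main.v *)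
Require Import Defs.
From HB Require Import structures.
From mathcomp Require Import all_boot all_order all_algebra.
From mathcomp Require Import reals.
From mathcomp Require Import zify.

Set Implicit Arguments.
Unset Strict Implicit.
Unset Printing Implicit Defensive.

(** Let [z] be the number of leaves of the star whose diagonal entry vanishes.
    Deleting the center leaves a diagonal matrix of nullity [z]; bordering it
    by the center row and column lowers the nullity to [z - 1] as soon as
    [z > 0], and gives nullity at most [1] when [z = 0].  Deleting a leaf
    gives a smaller star, to which the same count applies.  The pair (1, 1)
    cannot come from a star matrix without zero leaf entries: singularity of
    the star and of the star without the leaf [v] would both express the center
    entry as a sum of the [A 0 i * A i 0 / A i i], and the two sums differ by
    the nonzero term of [v]. *)

Import GRing.Theory Num.Theory.
Local Open Scope ring_scope.

(** * Rank and nullity of diagonal matrices *)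

Lemma rank_diagonal (F : fieldType) (n : nat) (D : 'M[F]_n) :
  (forall i j, i != j -> D i j = 0) -> \rank D = (\sum_i (D i i != 0%R))%N.
Proof.
elim: n D => [|n IHn] D diagD; first by rewrite big_ord0 thinmx0 mxrank0.
have DE : D = block_mx (ulsubmx (D : 'M_(1 + n))) 0 0
    (drsubmx (D : 'M_(1 + n))) :> 'M_(1 + n).
  rewrite -[LHS](@submxK _ 1 n 1 n); congr block_mx.
    by apply/matrixP=> i j; rewrite !mxE diagD //= -val_eqE /= ord1.
  by apply/matrixP=> i j; rewrite !mxE diagD //= -val_eqE /= [j]ord1.
rewrite -[LHS]/(@mxrank F (1 + n) (1 + n) D) [in LHS]DE rank_diag_block_mx big_ord_recl; congr addn.
  rewrite rank_rV; congr (nat_of_bool (~~ _)).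
  apply/eqP/eqP=> [/matrixP/(_ 0 0) | D00]; first by rewrite !mxE lshift0.
  by apply/matrixP=> i j; rewrite !ord1 !mxE lshift0.
rewrite IHn.
  by apply: eq_bigr => i _; rewrite !mxE !rshift1.
by move=> i j ij; rewrite !mxE diagD // -val_eqE.
Qed.

Lemma rank_ker_diagonal (F : fieldType) (n : nat) (D : 'M[F]_n) :
  (forall i j, i != j -> D i j = 0) ->
  \rank (kermx D) = (\sum_i (D i i == 0%R))%N.
Proof.
move=> /rank_diagonal rD; rewrite mxrank_ker rD.
suff nE : (\sum_i (D i i == 0%R) + \sum_i (D i i != 0%R))%N = n.
  by rewrite -[X in (X - _)%N]nE addnK.
rewrite -big_split /= -[RHS]card_ord -sum1_card.
by apply: eq_bigr => i _; case: eqP.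
Qed.

(** * Bordering a square matrix by one row and one column *)

Section Bordered.

Variables (F : fieldType) (n : nat).
Variables (a : 'M[F]_1) (r : 'rV[F]_n) (c : 'cV[F]_n) (D : 'M[F]_n).

(** The vector [y] forces the border coordinate of every kernel vector to vanish, so the kernel is
    the part of the kernel of [D] killed by [c]; [w] shows that [c] does not vanish on the kernel of
    [D], which costs exactly one dimension. *)
Lemma rank_ker_bordered (y : 'cV_n) (w : 'rV_n) :
  D *m y = 0 -> r *m y != 0 -> w *m D = 0 -> w *m c != 0 ->
  \rank (kermx (block_mx a r c D)) = (\rank (kermx D)).-1.
Proof.
move=> Dy ry wD wc; pose K := (kermx D :&: kermx c)%MS.
have kerK : (kermx (block_mx a r c D) :=: row_mx (0 : 'M_(n, 1)) K)%MS.
  apply/eqmxP/andP; split; last first.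
    apply/sub_kermxP; rewrite mul_row_block !mul0mx !add0r.
    have /sub_kermxP -> : (K <= kermx c)%MS by exact: capmxSr.
    have /sub_kermxP -> : (K <= kermx D)%MS by exact: capmxSl.
    by rewrite row_mx0.
  apply/rV_subP=> x /sub_kermxP; rewrite -[x]hsubmxK mul_row_block -row_mx0.
  move=> /eq_row_mx[ac rD].
  have x0 : lsubmx x = 0.
    (* Multiplying by [y] kills the [D] term and leaves the border coordinate times the nonzero
       scalar [r *m y]. *)
    have := congr1 (mulmx^~ y) rD.
    rewrite mulmxDl -!mulmxA Dy mulmx0 addr0 mul0mx.
    rewrite [lsubmx x]mx11_scalar mul_scalar_mx => /eqP.
    by rewrite scaler_eq0 (negPf ry) orbF => /eqP ->; rewrite raddf0.
  move: ac rD; rewrite x0 !mul0mx !add0r => yc yD.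
  have /submxP[B ->] : (rsubmx x <= K)%MS.
    by rewrite sub_capmx; apply/andP; split; apply/sub_kermxP.
  by apply/submxP; exists B; rewrite mul_mx_row mulmx0.
rewrite kerK rank_row_0mx /K -[X in _ = X.-1](mxrank_mul_ker (kermx D) c).
suff -> : \rank (kermx D *m c) = 1%N by [].
apply/eqP; rewrite eqn_leq rank_leq_col lt0n mxrank_eq0.
apply: contra wc => /eqP Kc.
have /submxP[B ->] : (w <= kermx D)%MS by exact/sub_kermxP.
by rewrite -mulmxA Kc mulmx0.
Qed.

(** [D] is a compression of the bordered matrix, so its rank is no larger, while the size differs by
    one. *)
Lemma rank_ker_bordered_le :
  (\rank (kermx (block_mx a r c D)) <= (\rank (kermx D)).+1)%N.
Proof.
suff : (\rank D <= \rank (block_mx a r c D))%N.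
  by have := rank_leq_row D; rewrite !mxrank_ker; lia.
set A := block_mx a r c D.
have -> : D = row_mx 0 1%:M *m A *m col_mx 0 1%:M.
  by rewrite mul_row_block mul_row_col !mul0mx !mul1mx mulmx0 !add0r mulmx1.
exact: leq_trans (mxrankM_maxl _ _) (mxrankM_maxr _ _).
Qed.

End Bordered.

(** * Star matrices and their zero leaf entries *)

Definition leaf_zeros (F : fieldType) (n : nat) (A : 'M[F]_n.+1) : nat :=
  (\sum_(i < n.+1 | i != ord0) (A i i == 0%R))%N.

Lemma big_leaves (T : Type) (idx : T) (op : Monoid.com_law idx) (n : nat)
    (f : 'I_n.+1 -> T) :
  \big[op/idx]_(i | i != ord0) f i = \big[op/idx]_i f (lift ord0 i).
Proof. by rewrite big_mkcond big_ord_recl eqxx /= Monoid.mul1m. Qed.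

Lemma leaf_zeros_le (F : fieldType) (n : nat) (A : 'M[F]_n.+1) :
  (leaf_zeros A <= n)%N.
Proof.
rewrite /leaf_zeros big_leaves -[X in (_ <= X)%N]card_ord -sum1_card.
by apply: leq_sum => i _; case: eqP.
Qed.

Lemma leaf_zeros_eq0 (F : fieldType) (n : nat) (A : 'M[F]_n.+1) :
  leaf_zeros A = 0%N -> forall i, i != ord0 -> A i i != 0.
Proof.
move=> /eqP; rewrite sum_nat_eq0 => /forallP zA i i0.
by have := zA i; rewrite i0 eqb0.
Qed.

Section StarMatrix.

Variables (R : realType) (n : nat) (A : 'M[R]_n.+1).
Hypothesis starA : sym_mx_of (star n) A.

Lemma star_row_neq0 i : i != ord0 -> A ord0 i != 0.
Proof. by move=> i0; rewrite starA.2 1?eq_sym //= /star_edge (negPf i0) eqxx. Qed.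

Lemma star_col_neq0 i : i != ord0 -> A i ord0 != 0.
Proof. by move=> i0; rewrite starA.2 //= /star_edge (negPf i0) eqxx. Qed.

Lemma star_leaves_eq0 i j : i != ord0 -> j != ord0 -> i != j -> A i j = 0.
Proof.
move=> i0 j0 ij; apply/eqP/negPn.
by rewrite starA.2 //= /star_edge (negPf i0) (negPf j0).
Qed.

Lemma del_centerE i j : del_rowcol ord0 A i j = A (lift ord0 i) (lift ord0 j).
Proof. by rewrite !mxE. Qed.

Lemma del_center_diagonal i j : i != j -> del_rowcol ord0 A i j = 0.
Proof.
by move=> ij; rewrite del_centerE star_leaves_eq0 // (inj_eq (@lift_inj _ _)).
Qed.

Lemma nullity_del_center : nullity (del_rowcol ord0 A) = leaf_zeros A.
Proof.
rewrite /nullity rank_ker_diagonal; last exact: del_center_diagonal.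
by rewrite /leaf_zeros big_leaves; apply: eq_bigr => i _; rewrite del_centerE.
Qed.

Lemma star_block :
  A = block_mx (ulsubmx (A : 'M_(1 + n))) (ursubmx (A : 'M_(1 + n)))
        (dlsubmx (A : 'M_(1 + n))) (del_rowcol ord0 A) :> 'M_(1 + n).
Proof.
rewrite -[LHS](@submxK _ 1 n 1 n); congr block_mx.
by apply/matrixP=> i j; rewrite !mxE !rshift1.
Qed.

(** The unit vector at a zero leaf lies in both kernels of the leaf block and meets the border in a
    nonzero edge entry, so it serves as both test vectors of [rank_ker_bordered]. *)
Lemma nullity_star_pos : (0 < leaf_zeros A)%N -> nullity A = (leaf_zeros A).-1.
Proof.
rewrite lt0n {1}/leaf_zeros sum_nat_eq0 negb_forall => /existsP[v].
rewrite negb_imply eqb0 negbK => /andP[v0 /eqP Avv].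
have [i vE] : exists i, v = lift ord0 i.
  by case: (unliftP ord0 v) v0 => [i -> _|->]; [exists i | rewrite eqxx].
rewrite -nullity_del_center /nullity {1}star_block.
have Dii : del_rowcol ord0 A i i = 0 by rewrite del_centerE -vE.
apply: (@rank_ker_bordered _ _ _ _ _ _ (delta_mx i 0) (delta_mx 0 i)).
- rewrite -colE; apply/matrixP=> j k; rewrite mxE [RHS]mxE.
  by have [->|/del_center_diagonal] := eqVneq j i.
- apply/eqP=> /matrixP/(_ 0 0); rewrite -colE !mxE rshift1 lshift0 -vE.
  exact/eqP/star_row_neq0.
- rewrite -rowE; apply/matrixP=> k j; rewrite mxE [RHS]mxE.
  by have [<-|/del_center_diagonal] := eqVneq i j.
- apply/eqP=> /matrixP/(_ 0 0); rewrite -rowE !mxE rshift1 lshift0 -vE.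
  exact/eqP/star_col_neq0.
Qed.

Lemma nullity_star_le1 : leaf_zeros A = 0%N -> (nullity A <= 1)%N.
Proof.
move=> zA; rewrite /nullity star_block.
rewrite (leq_trans (rank_ker_bordered_le _ _ _ _)) //.
by rewrite -/(nullity _) nullity_del_center zA.
Qed.

(** The leaf equations make each leaf coordinate of a kernel vector a multiple of its center
    coordinate, which is therefore nonzero and can be cancelled from the center equation. *)
Lemma singular_star_center :
  leaf_zeros A = 0%N -> nullity A != 0%N ->
  A ord0 ord0 = \sum_(i | i != ord0) A ord0 i * A i ord0 / A i i.
Proof.
move=> /leaf_zeros_eq0 dA; rewrite /nullity mxrank_eq0 => /rowV0Pn[x].
move=> /sub_kermxP /matrixP xA x_neq0.
have leafE i : i != ord0 -> x 0 i = - (x 0 ord0 * A ord0 i / A i i).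
  move=> i0; have := xA 0 i; rewrite !mxE (bigD1 ord0) //= (bigD1 i) //= big1.
    rewrite addr0 => /eqP; rewrite addrC addr_eq0 => /eqP xi.
    by rewrite -mulNr -xi mulfK ?dA.
  by move=> j /andP[j0 ji]; rewrite star_leaves_eq0 ?mulr0.
have x0 : x 0 ord0 != 0.
  apply: contra x_neq0 => /eqP x0; apply/eqP/rowP=> i; rewrite mxE.
  by have [-> //|/leafE ->] := eqVneq i ord0; rewrite x0 !mul0r oppr0.
have := xA 0 ord0; rewrite !mxE (bigD1 ord0) //= => /eqP; rewrite addr_eq0.
move=> /eqP xA0; apply: (mulfI x0); rewrite xA0 -sumrN mulr_sumr.
apply: eq_bigr => i /leafE ->.
by rewrite mulNr opprK -!mulrA [A i ord0 / _]mulrC.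
Qed.

End StarMatrix.

(** * Deleting a leaf *)

Section DeleteLeaf.

Variables (R : realType) (n : nat) (A : 'M[R]_n.+2) (v : 'I_n.+2).
Hypothesis v0 : v != ord0.

(** The center has index 0, below any leaf [v], and [lift v] fixes the indices below [v]; so
    deletion yields a standard star without relabelling. *)
Lemma lift_leaf_center : lift v (ord0 : 'I_n.+1) = ord0.
Proof. by apply/val_inj; rewrite /= /bump leqNgt lt0n v0. Qed.

Lemma lift_leaf_eq0 (i : 'I_n.+1) : (lift v i == ord0) = (i == ord0).
Proof. by rewrite -[ord0 in LHS]lift_leaf_center (inj_eq (@lift_inj _ _)). Qed.

Lemma del_leafE (i j : 'I_n.+1) : del_rowcol v A i j = A (lift v i) (lift v j).
Proof. by rewrite !mxE. Qed.

Lemma star_del_leaf :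
  sym_mx_of (star n.+1) A -> sym_mx_of (star n) (del_rowcol v A).
Proof.
move=> [symA edgeA]; split.
  by apply/matrixP=> i j; rewrite mxE !del_leafE -{1}symA mxE.
move=> i j ij; rewrite del_leafE edgeA ?(inj_eq (@lift_inj _ _)) //.
by rewrite /= /star_edge !lift_leaf_eq0.
Qed.

Lemma leaf_zeros_del_leaf :
  leaf_zeros A = ((A v v == 0%R) + leaf_zeros (del_rowcol v A : 'M_n.+1))%N.
Proof.
rewrite /leaf_zeros (bigD1_ord _ v0); congr addn.
by apply: eq_big => i; rewrite ?lift_leaf_eq0 // del_leafE.
Qed.

Lemma star_or_del_leaf_nonsingular :
  sym_mx_of (star n.+1) A -> leaf_zeros A = 0%N ->
  (nullity A == 0%N) || (nullity (del_rowcol v A) == 0%N).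
Proof.
move=> starA zA; have := zA; rewrite leaf_zeros_del_leaf => /eqP.
rewrite addn_eq0 => /andP[_ /eqP zA']; have dA := leaf_zeros_eq0 zA.
apply: contraT; rewrite negb_or => /andP[sA sA'].
have := singular_star_center (star_del_leaf starA) zA' sA'.
rewrite del_leafE !lift_leaf_center (singular_star_center starA zA sA).
rewrite (bigD1_ord _ v0) (eq_bigl (fun i => i != ord0)); last first.
  by move=> i; rewrite lift_leaf_eq0.
under [RHS]eq_bigr do rewrite !del_leafE lift_leaf_center.
(* Cancelling the common sum leaves the term of [v] equal to zero, although its three factors are
   nonzero. *)
move=> /(canRL (addrK _)) /eqP; rewrite subrr !mulf_eq0 invr_eq0.
rewrite (negPf (star_row_neq0 starA v0)) (negPf (star_col_neq0 starA v0)).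
by rewrite (negPf (dA _ v0)).
Qed.

End DeleteLeaf.

(** * Star matrices with prescribed diagonal zeros *)

Section Realization.

Variables (R : realType) (n : nat) (Z : {set 'I_n.+1}).

(** The adjacency matrix of the star plus the diagonal indicator of the complement of [Z]. *)
Definition star_mx : 'M[R]_n.+1 :=
  \matrix_(i, j) (star_edge i j || (i == j) && (i \notin Z))%:R.

Lemma star_mx_star : sym_mx_of (star n) star_mx.
Proof.
split.
  apply/matrixP=> i j; rewrite !mxE star_edge_sym eq_sym.
  by case: eqP => // ->.
by move=> i j ij; rewrite mxE (negPf ij) orbF pnatr_eq0 eqb0 negbK.
Qed.

Lemma star_mx_diag i : (star_mx i i == 0) = (i \in Z).
Proof. by rewrite mxE star_edge_irr eqxx /= pnatr_eq0 eqb0 negbK. Qed.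

Lemma leaf_zeros_star_mx : ord0 \notin Z -> leaf_zeros star_mx = #|Z|.
Proof.
move=> Z0; rewrite /leaf_zeros -sum1_card big_mkcond [RHS]big_mkcond /=.
apply: eq_bigr => i _; rewrite star_mx_diag.
by have [->|_] /= := eqVneq i ord0; [rewrite (negPf Z0) | case: (i \in Z)].
Qed.

End Realization.

Lemma subset_of_card (T : finType) (B : {set T}) (k : nat) :
  (k <= #|B|)%N -> exists2 Z : {set T}, Z \subset B & #|Z| = k.
Proof.
rewrite -bin_gt0 -cards_draws => /card_gt0P[Z]; rewrite inE => /andP[ZB /eqP].
by exists Z.
Qed.

Local Close Scope ring_scope.

Theorem proposition4p6 (R : realType) (n : nat) (hn : 3 <= n) :
  (forall p : nat * nat,
     (allows_nullity_pair R (star n) ord0 p /\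
      p \notin [:: (0, 0); (1, 0); (0, 1)])
     <-> (exists2 l : nat, 2 <= l <= n & p = (l - 1, l)))
  /\
  (forall v : 'I_n.+1, v != ord0 ->
   forall p : nat * nat,
     (allows_nullity_pair R (star n) v p /\
      p \notin [:: (0, 0); (1, 0); (0, 1)])
     <-> (exists2 l : nat, 1 <= l <= n - 2 & p = (l, l) \/ p = (l + 1, l))).
Proof.
split=> [p | v v0 p].
  split=> [[[A starA <-]] | [l lb ->]].
    rewrite (nullity_del_center starA) => p_notin; exists (leaf_zeros A).
      rewrite leaf_zeros_le andbT.
      (* No zero leaf gives (0,0) or (1,0), and a single one gives (0,1); all are excluded, so there
         are at least two. *)
      case: (posnP (leaf_zeros A)) p_notin => [zA|zA].
        by rewrite zA; have:= nullity_star_le1 starA zA; case: nullity => [|[|]].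
      by rewrite (nullity_star_pos starA zA); case: leaf_zeros zA => [|[|]].
    case: (posnP (leaf_zeros A)) p_notin => [zA|zA _].
      by rewrite zA; have:= nullity_star_le1 starA zA; case: nullity => [|[|]].
    by rewrite (nullity_star_pos starA zA) subn1.
  have [|Z ZB Zl] := @subset_of_card _ [set~ (ord0 : 'I_n.+1)] l.
    by rewrite cardsC1 card_ord; lia.
  have Z0 : ord0 \notin Z by apply/negP=> /(subsetP ZB); rewrite !inE eqxx.
  have starA := star_mx_star R Z.
  have zA := leaf_zeros_star_mx R Z0.
  split; last by rewrite !inE !xpair_eqE; lia.
  exists (star_mx R Z) => //.
  rewrite (nullity_del_center starA) (nullity_star_pos starA) zA Zl ?subn1 //.
  by lia.
(* From here on the star has [n.+1] leaves, and [n] after the deletion. *)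
case: n hn v v0 => [|n] // hn v v0; split=> [[[A starA <-]] | [l lb pE]].
  have := leaf_zeros_del_leaf A v0; have := star_del_leaf v0 starA.
  have := star_or_del_leaf_nonsingular v0 starA.
  have := leaf_zeros_le (del_rowcol v A : 'M_n.+1).
  set B : 'M_n.+1 := del_rowcol v A => zB_le singular starB zAB p_notin.
  case: (posnP (leaf_zeros B)) => zB; last first.
    have zA : 0 < leaf_zeros A by rewrite zAB; lia.
    move: p_notin; rewrite !inE !xpair_eqE.
    rewrite (nullity_star_pos starA zA) (nullity_star_pos starB zB) zAB.
    (* A zero at [v] counts for [A] but not for [B], hence the two shapes of pairs; the value 0 of
       the witness would give the excluded (0,0) or (1,0). *)
    case: (A v v == 0%R) => p_notin; exists (leaf_zeros B).-1; try lia.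
      by right; congr pair; lia.
    by left.
  (* With no zero leaf except possibly [v], only excluded pairs arise: a zero at [v] makes [A]
     nonsingular, and otherwise [A] or [B] is nonsingular while both nullities are at most 1. *)
  have := nullity_star_le1 starB zB.
  case: (posnP (leaf_zeros A)) => zA.
    have := nullity_star_le1 starA zA; have := singular zA.
    move: p_notin; rewrite -/B.
    by case: nullity => [|[|]] //; case: nullity => [|[|]].
  move: p_notin; rewrite (nullity_star_pos starA zA) zAB zB addn0.
  by case: (A v v == 0%R); case: nullity => [|[|]].
(* Nullity [l] after the deletion requires [l.+1] zero leaves other than [v]. *)
have [|Z0 Z0B Z0l] := @subset_of_card _ (~: [set ord0; v]) l.+1.
  have := cardsC [set ord0; v]; rewrite cards2 eq_sym v0 card_ord; lia.
have /andP[c_notin v_notin] : (ord0 \notin Z0) && (v \notin Z0).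
  by apply/andP; split; apply/negP=> /(subsetP Z0B); rewrite !inE eqxx ?orbT.
(* Adding [v] raises the nullity of the whole matrix by one and leaves that of the deletion
   unchanged. *)
pose Z := if p.1 == l then Z0 else v |: Z0.
have Zc : ord0 \notin Z.
  by rewrite /Z; case: ifP => // _; rewrite !inE eq_sym (negPf v0).
have ZE : #|Z| = (v \in Z) + l.+1.
  by rewrite /Z; case: ifP => _; rewrite ?cardsU1 ?setU11 (negPf v_notin) Z0l.
have pZ : p = ((v \in Z) + l, l).
  rewrite /Z; case: pE => -> /=; first by rewrite eqxx (negPf v_notin).
  by rewrite -[X in _ == X]addn0 eqn_add2l setU11 addnC.
split; last by rewrite !inE pZ !xpair_eqE; lia.
have starA := star_mx_star R Z.
have := leaf_zeros_del_leaf (star_mx R Z) v0.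
rewrite leaf_zeros_star_mx // star_mx_diag ZE => /addnI zB.
exists (star_mx R Z) => //.
rewrite (nullity_star_pos starA) leaf_zeros_star_mx // ZE ?addnS //.
by rewrite (nullity_star_pos (star_del_leaf v0 starA)) -zB // pZ.
Qed.
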